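(* Let $n\ge 1$, let $\lambda_0\in\mathbb{C}$, and let $\lambda_1^{\mathcal{C}},\dots,\lambda_n^{\mathcal{C}},\lambda_1^{\mathcal{B}},\dots,\lambda_n^{\mathcal{B}}\in\mathbb{C}$. Put $X=\{\lambda_1^{\mathcal{C}},\dots,\lambda_n^{\mathcal{C}}\}$, $Y=\{\lambda_1^{\mathcal{B}},\dots,\lambda_n^{\mathcal{B}}\}$, and for $\lambda\in X$ (resp. $\lambda\in Y$) write $X_\lambda=X\setminus\{\lambda\}$ (resp. $Y_\lambda=Y\setminus\{\lambda\}$). For $\lambda=\lambda_k^{\mathcal{C}}\in X$, let $\vec X^{0,n}_\lambda$ denote the $n$-tuple obtained from $(\lambda_0,\lambda_1^{\mathcal{C}},\dots,\lambda_n^{\mathcal{C}})$ by deleting the entry $\lambda_k^{\mathcal{C}}$; similarly, for $\lambda=\lambda_k^{\mathcal{B}}\in Y$, let $\vec Y^{0,n}_\lambda$ be obtained from $(\lambda_0,\lambda_1^{\mathcal{B}},\dots,\lambda_n^{\mathcal{B}})$ by deleting $\lambda_k^{\mathcal{B}}$. Define $$M_0=\Lambda_{\mathcal{A}}(\lambda_0)\Big\{\prod_{\lambda\in Y}\frac{a(\lambda-\lambda_0)}{b(\lambda-\lambda_0)}\frac{b(\lambda+\lambda_0)}{a(\lambda+\lambda_0)}-\prod_{\lambda\in X}\frac{a(\lambda-\lambda_0)}{b(\lambda-\lambda_0)}\frac{b(\lambda+\lambda_0)}{a(\lambda+\lambda_0)}\Big\},$$ $$N^{(\mathcal{C})}_\lambda=\Lambda_{\mathcal{A}}(\lambda)\frac{c}{b(\lambda-\lambda_0)}\frac{b(2\lambda)}{a(2\lambda)}\prod_{\tilde\lambda\in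 X_\lambda}\frac{a(\tilde\lambda-\lambda)}{b(\tilde\lambda-\lambda)}\frac{b(\tilde\lambda+\lambda)}{a(\tilde\lambda+\lambda)}+\Lambda_{\tilde{\mathcal{D}}}(\lambda)\frac{c}{a(\lambda+\lambda_0)}\prod_{\tilde\lambda\in X_\lambda}\frac{a(\lambda-\tilde\lambda)}{b(\lambda-\tilde\lambda)}\frac{a(\lambda+\tilde\lambda+\gamma)}{b(\lambda+\tilde\lambda+\gamma)}$$ for $\lambda\in X$, and $$N^{(\mathcal{B})}_\lambda=-\Lambda_{\mathcal{A}}(\lambda)\frac{c}{b(\lambda-\lambda_0)}\frac{b(2\lambda)}{a(2\lambda)}\prod_{\tilde\lambda\in Y_\lambda}\frac{a(\tilde\lambda-\lambda)}{b(\tilde\lambda-\lambda)}\frac{b(\tilde\lambda+\lambda)}{a(\tilde\lambda+\lambda)}-\Lambda_{\tilde{\mathcal{D}}}(\lambda)\frac{c}{a(\lambda+\lambda_0)}\prod_{\tilde\lambda\in Y_\lambda}\frac{a(\lambda-\tilde\lambda)}{b(\lambda-\tilde\lambda)}\frac{a(\lambda+\tilde\lambda+\gamma)}{b(\lambda+\tilde\lambda+\gamma)}$$ for $\lambda\in Y$. Then the scalar product satisfies $$M_0\,\mathcal{S}_n(\lambda_1^{\mathcal{C}},\dots,\lambda_n^{\mathcal{C}}\,|\,\lambda_1^{\mathcal{B}},\dots,\lambda_n^{\mathcal{B}})+\sum_{\lambda\in X}N^{(\mathcal{C})}_\lambda\,\mathcal{S}_n(\vec X^{0,n}_\lambda\,|\,\lambda_1^{\mathcal{B}},\dots,\lambda_n^{\mathcal{B}})+\sum_{\lambda\in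 Y}N^{(\mathcal{B})}_\lambda\,\mathcal{S}_n(\lambda_1^{\mathcal{C}},\dots,\lambda_n^{\mathcal{C}}\,|\,\vec Y^{0,n}_\lambda)=0.$$
   Context: Fix generic $\gamma,h\in\mathbb{C}$, an integer $L\ge1$ and inhomogeneities $\mu_1,\dots,\mu_L\in\mathbb{C}$. Set $a(\lambda)=\sinh(\lambda+\gamma)$, $b(\lambda)=\sinh(\lambda)$, $c=c(\lambda)=\sinh(\gamma)$ (a constant). Let $\mathcal{R}(\lambda)\in\mathrm{End}(\mathbb{C}^2\otimes\mathbb{C}^2)$ be the six-vertex ($\mathcal{U}_q[\widehat{\mathfrak{sl}}(2)]$-invariant) R-matrix, which in the basis $e_1\otimes e_1,e_1\otimes e_2,e_2\otimes e_1,e_2\otimes e_2$ is $\begin{pmatrix}a(\lambda)&0&0&0\\0&b(\lambda)&c&0\\0&c&b(\lambda)&0\\0&0&0&a(\lambda)\end{pmatrix}$, and let $\mathcal{K}(\lambda)=\mathrm{diag}(\sinh(h+\lambda),\sinh(h-\lambda))$. With an auxiliary space $V_0\cong\mathbb{C}^2$ and quantum space $V_{\mathcal{Q}}=(\mathbb{C}^2)^{\otimes L}$ (sites $1,\dots,L$), $\mathcal{R}_{0j}$ denotes $\mathcal{R}$ acting on $V_0\otimes V_j$ and $\mathcal{K}_0$ denotes $\mathcal{K}$ acting on $V_0$. Operators $\mathcal{A},\mathcal{B},\mathcal{C},\mathcal{D}(\lambda)\in\mathrm{End}(V_{\mathcal{Q}})$ are defined by $\mathcal{R}_{0L}(\lambda-\mu_L)\cdots\mathcal{R}_{01}(\lambda-\mu_1)\,\mathcal{K}_0(\lambda)\,\mathcal{R}_{01}(\lambda+\mu_1)\cdots\mathcal{R}_{0L}(\lambda+\mu_L)=\begin{pmatrix}\mathcal{A}(\lambda)&\mathcal{B}(\lambda)\\\mathcal{C}(\lambda)&\mathcal{D}(\lambda)\end{pmatrix}$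 (a $2\times2$ matrix on $V_0$). Let $|0\rangle=(1,0)^{T\otimes L}$ and $\langle 0|=(1,0)^{\otimes L}$. The off-shell scalar product is $\mathcal{S}_n(\lambda_1^{\mathcal{C}},\dots,\lambda_n^{\mathcal{C}}\,|\,\lambda_1^{\mathcal{B}},\dots,\lambda_n^{\mathcal{B}})=\langle0|\mathcal{C}(\lambda_n^{\mathcal{C}})\cdots\mathcal{C}(\lambda_1^{\mathcal{C}})\mathcal{B}(\lambda_1^{\mathcal{B}})\cdots\mathcal{B}(\lambda_n^{\mathcal{B}})|0\rangle$ for arbitrary complex variables. Also $\Lambda_{\mathcal{A}}(\lambda)=b(h+\lambda)\prod_{j=1}^L a(\lambda-\mu_j)a(\lambda+\mu_j)$ and $\Lambda_{\tilde{\mathcal{D}}}(\lambda)=-\frac{b(2\lambda)}{a(2\lambda)}a(\lambda-h)\prod_{j=1}^L b(\lambda-\mu_j)b(\lambda+\mu_j)$. The identity is understood as an identity of meromorphic functions of all the variables. *)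

(* Defs.v *)
From HB Require Import structures.
From mathcomp Require Import all_boot all_order all_algebra.
From mathcomp Require Import complex.
From mathcomp Require Import reals sequences exp trigo.
Set Implicit Arguments. Unset Strict Implicit. Unset Printing Implicit Defensive.
Import Order.TTheory GRing.Theory Num.Theory.
Local Open Scope ring_scope.
Local Open Scope complex_scope.

Definition rsinh (R : realType) (x : R) : R := (expR x - expR (- x)) / 2.
Definition rcosh (R : realType) (x : R) : R := (expR x + expR (- x)) / 2.
Definition csinh (R : realType) (z : R[i]) : R[i] :=
  let: x +i* y := z in (rsinh x * cos y) +i* (rcosh x * sin y).

Definition wa (R : realType) (g lam : R[i]) : R[i] := csinh (lam + g).
Definition wb (R : realType) (lam : R[i]) : R[i] := csinh lam.
Definition wc (R : realType) (g : R[i]) : R[i] := csinh g.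

(* Basis of V_Q = (C^2)^{(x)L}: configurations s : 'I_L -> bool, where
   false = e_1 and true = e_2.  Basis of V_0 (x) V_Q: pairs (alpha, s). *)
Definition conf (L : nat) := {ffun 'I_L -> bool}.
Definition fconf (L : nat) := (bool * conf L)%type.

Definition Op (R : realType) (I : finType) := I -> I -> R[i].
Definition opmul (R : realType) (I : finType) (A B : Op R I) : Op R I :=
  fun x y => \sum_(z : I) A x z * B z y.
Definition opid (R : realType) (I : finType) : Op R I :=
  fun x y => if x == y then 1 else 0.

(* R-matrix entry <alpha,x| R(lam) |beta,y>, alpha,beta auxiliary indices *)
Definition Rent (R : realType) (g lam : R[i]) (al x be y : bool) : R[i] :=
  if (al == be) && (x == y) then (if al == x then wa g lam else wb lam)
  else if (al == y) && (be == x) then wc g else 0.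

Definition R0j (R : realType) (L : nat) (g lam : R[i]) (j : 'I_L) : Op R (fconf L) :=
  fun p q => Rent g lam p.1 (p.2 j) q.1 (q.2 j) *
             (if [forall k, (k != j) ==> (p.2 k == q.2 k)] then 1 else 0).

Definition K0 (R : realType) (L : nat) (h lam : R[i]) : Op R (fconf L) :=
  fun p q => if p == q then (if p.1 then csinh (h - lam) else csinh (h + lam)) else 0.

Definition monodromy (R : realType) (L : nat) (g h : R[i]) (mu : 'I_L -> R[i])
  (lam : R[i]) : Op R (fconf L) :=
  opmul (opmul (\big[@opmul R _/@opid R _]_(j <- rev (enum 'I_L)) R0j g (lam - mu j) j)
               (@K0 R L h lam))
        (\big[@opmul R _/@opid R _]_(j <- enum 'I_L) R0j g (lam + mu j) j).

Definition Aop (R : realType) (L : nat) (g h : R[i]) (mu : 'I_L -> R[i]) (lam : R[i])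
  : Op R (conf L) :=
  fun s t => @monodromy R L g h mu lam (false, s) (false, t).
Definition Bop (R : realType) (L : nat) (g h : R[i]) (mu : 'I_L -> R[i]) (lam : R[i])
  : Op R (conf L) :=
  fun s t => @monodromy R L g h mu lam (false, s) (true, t).
Definition Cop (R : realType) (L : nat) (g h : R[i]) (mu : 'I_L -> R[i]) (lam : R[i])
  : Op R (conf L) :=
  fun s t => @monodromy R L g h mu lam (true, s) (false, t).
Definition Dop (R : realType) (L : nat) (g h : R[i]) (mu : 'I_L -> R[i]) (lam : R[i])
  : Op R (conf L) :=
  fun s t => @monodromy R L g h mu lam (true, s) (true, t).

Definition vac (L : nat) : conf L := [ffun _ => false].

Definition scalprod (R : realType) (L : nat) (g h : R[i]) (mu : 'I_L -> R[i])
  (n : nat) (xC xB : 'I_n -> R[i]) : R[i] :=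
  opmul (\big[@opmul R _/@opid R _]_(k <- rev (enum 'I_n)) Cop g h mu (xC k))
        (\big[@opmul R _/@opid R _]_(k <- enum 'I_n) Bop g h mu (xB k))
        (vac L) (vac L).

Definition LamA (R : realType) (L : nat) (g h : R[i]) (mu : 'I_L -> R[i]) (lam : R[i]) :=
  wb (h + lam) * \prod_(j < L) (wa g (lam - mu j) * wa g (lam + mu j)).
Definition LamDt (R : realType) (L : nat) (g h : R[i]) (mu : 'I_L -> R[i]) (lam : R[i]) :=
  - (wb (2 * lam) / wa g (2 * lam)) * wa g (lam - h) *
    \prod_(j < L) (wb (lam - mu j) * wb (lam + mu j)).

(* the n-tuple obtained from (lam0, x_1, ..., x_n) by deleting x_{k+1}
   (here x is indexed 0..n-1, so x k is deleted) *)
Definition del0 (R : realType) (n : nat) (lam0 : R[i]) (x : 'I_n -> R[i]) (k : 'I_n)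
  : 'I_n -> R[i] :=
  fun i => nth 0 (lam0 :: [seq x j | j <- enum 'I_n]) (if (i <= k)%N then (i : nat) else i.+1).

Definition M0 (R : realType) (L : nat) (g h : R[i]) (mu : 'I_L -> R[i]) (n : nat)
  (lam0 : R[i]) (xC xB : 'I_n -> R[i]) : R[i] :=
  LamA g h mu lam0 *
  (\prod_(k < n) (wa g (xB k - lam0) / wb (xB k - lam0) *
                  (wb (xB k + lam0) / wa g (xB k + lam0)))
   - \prod_(k < n) (wa g (xC k - lam0) / wb (xC k - lam0) *
                  (wb (xC k + lam0) / wa g (xC k + lam0)))).

(* N^{(C)}_lambda for lambda = x k (x = xC); N^{(B)} is its negative with x = xB *)
Definition Ncoef (R : realType) (L : nat) (g h : R[i]) (mu : 'I_L -> R[i]) (n : nat)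
  (lam0 : R[i]) (x : 'I_n -> R[i]) (k : 'I_n) : R[i] :=
  let lam := x k in
  LamA g h mu lam * (wc g / wb (lam - lam0)) * (wb (2 * lam) / wa g (2 * lam)) *
    \prod_(j < n | j != k) (wa g (x j - lam) / wb (x j - lam) *
                            (wb (x j + lam) / wa g (x j + lam)))
  + LamDt g h mu lam * (wc g / wa g (lam + lam0)) *
    \prod_(j < n | j != k) (wa g (lam - x j) / wb (lam - x j) *
                            (wa g (lam + x j + g) / wb (lam + x j + g))).

(* Main.v *)
Require Import Defs.
From HB Require Import structures.
From mathcomp Require Import all_boot all_order all_algebra.
From mathcomp Require Import complex ring.
From mathcomp Require Import boolp reals sequences exp trigo.
Set Implicit Arguments. Unset Strict Implicit. Unset Printing Implicit Defensive.
Import Order.TTheory GRing.Theory Num.Theory.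
Local Open Scope ring_scope.
Local Open Scope complex_scope.

(* Evaluate <0|C..C A(lam0) B..B|0> in two ways.  To the right, the algebraic
   Bethe ansatz writes A(lam0) B(x_1)..B(x_n)|0> as a multiple of B..B|0> plus
   terms in which one x_k is replaced by lam0; to the left the same formula
   applies to the C's, because transposing the double-row monodromy matrix
   amounts to mu -> -mu and exchanges B and C.  The difference of the two
   expansions is the functional equation.

   The exchange relations come from the reflection equation, which is proved by
   adding one site at a time with the Yang-Baxter equation.  Two of them carry
   a spurious factor that may vanish at the given spectral parameters; it is
   cancelled because all matrix entries are Laurent polynomials in exp(lam).
   The coefficients of the Bethe expansion are then verified by induction on n,
   which reduces to one trigonometric cocycle identity in three variables. *)

(** * Hyperbolic functions and the coefficients of the exchange relations *)

Section Trig.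
Variable R : realType.
Implicit Types x y z u v g : R[i].

Definition cexp (z : R[i]) : R[i] :=
  let: x +i* y := z in (expR x * cos y) +i* (expR x * sin y).

Lemma cexp0 : cexp 0 = 1.
Proof. by rewrite /= expR0 cos0 sin0 mul1r mulr0. Qed.

Lemma cexpD u v : cexp (u + v) = cexp u * cexp v.
Proof.
case: u v => [a b] [c d]; rewrite /= expRD cosD sinD.
by apply/eqP; rewrite eq_complex /=; apply/andP; split; apply/eqP; ring.
Qed.

Lemma cexp_mulN z : cexp z * cexp (- z) = 1.
Proof. by rewrite -cexpD subrr cexp0. Qed.

Lemma cexp_neq0 z : cexp z != 0.
Proof.
by apply/eqP => e; move: (cexp_mulN z); rewrite e mul0r => /esym/eqP; rewrite oner_eq0.
Qed.

Lemma cexpN z : cexp (- z) = (cexp z)^-1.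
Proof.
by apply: (mulfI (cexp_neq0 z)); rewrite cexp_mulN mulfV ?cexp_neq0.
Qed.

Lemma cexp2 z : cexp (2 * z) = cexp z ^+ 2.
Proof. by rewrite mulr_natl mulr2n cexpD expr2. Qed.

(** Turns the hyperbolic identities below into rational identities in exponentials of the
    parameters, within reach of [field]. *)
Lemma csinhE z : csinh z = (cexp z - (cexp z)^-1) / 2.
Proof.
rewrite -cexpN; case: z => a b; rewrite /= /rsinh /rcosh cosN sinN.
have -> : (2 : R[i]) = (2 : R)%:C by rewrite rmorphD rmorph1.
rewrite -fmorphV.
by apply/eqP; rewrite eq_complex /=; apply/andP; split; apply/eqP; ring.
Qed.

Lemma two_neq0 : (2 : R[i]) != 0.
Proof. by rewrite pnatr_eq0. Qed.

End Trig.

Ltac trig_field :=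
  rewrite /wa /wb /wc ?csinhE ?(cexpD, cexpN, cexp2); field;
  rewrite ?two_neq0 ?cexp_neq0 //.

Section TrigIds.
Variable R : realType.
Implicit Types l m y u v g : R[i].
Local Notation e := (@cexp R).

(* Index false stands for A(l), index true for D~(l) = D(l) - c / a(2 l) A(l). *)
Definition wal g (i : bool) l m : R[i] :=
  if i then wa g (l - m) / wb (l - m) * (wa g (l + m + g) / wb (l + m + g))
  else wa g (m - l) / wb (m - l) * (wb (m + l) / wa g (m + l)).

(** When X_i(l) moves to the right through B(m), [wal] weights the term where both keep their
    parameters and [wbe] the terms B(l) X_j(m) where the parameters are swapped; see
    [opX_exchange]. *)
Definition wbe g (i j : bool) l m : R[i] :=
  match i, j with
  | false, false => - (wc g / wb (m - l) * (wb (2 * m) / wa g (2 * m)))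
  | false, true => - (wc g / wa g (m + l))
  | true, false =>
      wc g / wa g (m + l) * (wb (2 * m) / wa g (2 * m)) * (wb (2 * l + 2 * g) / wa g (2 * l))
  | true, true => wc g / wb (m - l) * (wb (2 * l + 2 * g) / wa g (2 * l))
  end.

(* Here and in [csinh_cexp_neq0] the conclusion has the shape in which [field] leaves its side conditions. *)
Lemma wb_cexp_neq0 u v : wb (u - v) != 0 -> e u * e u + - e v * e v != 0.
Proof.
apply: contra => /eqP h; apply/eqP.
have -> : wb (u - v) = (e u * e u + - e v * e v) / (2 * e u * e v).
  by trig_field.
by rewrite h mul0r.
Qed.

Lemma csinh_cexp_neq0 z : csinh z != 0 -> e z * e z - 1 != 0.
Proof.
apply: contra => /eqP h; apply/eqP.
have -> : csinh z = (e z * e z - 1) / (2 * e z) by trig_field.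
by rewrite h mul0r.
Qed.

Lemma wb_subC_neq0 u v : (wb (u - v) != 0) = (wb (v - u) != 0).
Proof.
have -> : wb (u - v) = - wb (v - u) by trig_field.
by rewrite oppr_eq0.
Qed.

(** Compares the ways of reaching B(l) B(m) X_j(y) from X_i(l) B(m) B(y). Left: X_i(l) passes m and
    swaps with y, or swaps with m, after which X_k(m) swaps with y. Right: with the B's reordered,
    X_i(l) swaps with y first, and X_j(y) passes m. *)
Lemma wbe_cocycle g (i j : bool) l m y :
  wb (m - l) != 0 -> wa g (m + l) != 0 ->
  wb (y - l) != 0 -> wa g (y + l) != 0 ->
  wb (y - m) != 0 -> wa g (y + m) != 0 ->
  wa g (2 * m) != 0 -> wa g (2 * y) != 0 -> (i -> wa g (2 * l) != 0) ->
  wal g i l m * wbe g i j l y + \sum_(k : bool) wbe g i k l m * wbe g k j m y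
  = wbe g i j l y * wal g j y m.
Proof.
rewrite big_bool /= => h1 h2 h3 h4 h5 h6 h7 h8 h9.
have {}h1 := (wb_cexp_neq0 h1, wb_cexp_neq0 (etrans (wb_subC_neq0 _ _) h1)).
have {}h3 := (wb_cexp_neq0 h3, wb_cexp_neq0 (etrans (wb_subC_neq0 _ _) h3)).
have {}h5 := (wb_cexp_neq0 h5, wb_cexp_neq0 (etrans (wb_subC_neq0 _ _) h5)).
have h2' := h2; rewrite (addrC m) in h2'.
have h4' := h4; rewrite (addrC y) in h4'.
have h6' := h6; rewrite (addrC y) in h6'.
have H2 := (csinh_cexp_neq0 h2, csinh_cexp_neq0 h2', csinh_cexp_neq0 h4, csinh_cexp_neq0 h4',
  csinh_cexp_neq0 h6, csinh_cexp_neq0 h6').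
have H7 := (csinh_cexp_neq0 h7, csinh_cexp_neq0 h8).
rewrite !(cexpD, cexp2) in H2 H7.
have {}h9 : i -> e l ^+ 2 * e g * (e l ^+ 2 * e g) - 1 != 0.
  by move/h9/csinh_cexp_neq0; rewrite cexpD cexp2.
case: i h9 => h9; case: j;
  rewrite /wal /wbe; trig_field; rewrite ?h1 ?h3 ?h5 ?H2 ?H7 ?h9 //.
Qed.

End TrigIds.

(** * Algebraic Bethe ansatz *)

Section BetheAnsatz.
Variables (F : fieldType) (V : lmodType F) (I : finType) (P : Type).
Variables (B : P -> {linear V -> V}) (X : I -> P -> {linear V -> V}).
Variables (al : I -> P -> P -> F) (be : I -> I -> P -> P -> F).
Variables (Lam : I -> P -> F) (Om : V) (ok : I -> P -> Prop) (good : rel P).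

Definition dels (k : nat) (s : seq P) := take k s ++ drop k.+1 s.

Lemma dels0 m s : dels 0 (m :: s) = s.
Proof. by rewrite /dels /= drop0. Qed.

Definition bethe (s : seq P) : V := foldr (fun m v => B m v) Om s.

Definition bethe_weight (j : I) (y : P) (s : seq P) : F :=
  Lam j y * \prod_(m <- s) al j y m.

Hypothesis B_comm : forall l m v, B l (B m v) = B m (B l v).
Hypothesis exchange : forall i l m v, ok i l -> (forall j, ok j m) -> good l m ->
  X i l (B m v) = al i l m *: B m (X i l v) + \sum_j be i j l m *: B l (X j m v).
Hypothesis vacuum : forall i l, ok i l -> X i l Om = Lam i l *: Om.
Hypothesis cocycle : forall i j l m y, ok i l ->
  (forall k, ok k m) -> (forall k, ok k y) ->
  good l m -> good l y -> good m y ->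
  al i l m * be i j l y + \sum_k be i k l m * be k j m y = be i j l y * al j y m.

(** Induction on [s], for all [i] and [l] at once: a swap at the head [m] leaves X_j(m) acting on
    the tail, so the induction hypothesis serves both for [l] and for [m]. The [cocycle] then merges
    the resulting coefficients. *)
Lemma bethe_action (i : I) (l x0 : P) (s : seq P) :
  ok i l -> (forall k : 'I_(size s), forall j, ok j (nth x0 s k)) ->
  all (good l) s -> pairwise good s ->
  X i l (bethe s) = bethe_weight i l s *: bethe s
   + \sum_(k < size s) (\sum_j be i j l (nth x0 s k) *
         bethe_weight j (nth x0 s k) (dels k s)) *: B l (bethe (dels k s)).
Proof.
elim: s i l => [|m s IH] i l okl oks /=.
  by move=> _ _; rewrite big_ord0 addr0 /bethe_weight big_nil mulr1 vacuum.
case/andP=> glm gls /andP[gms gs].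
have okm j : ok j m by exact: (oks ord0 j).
have oks' (k : 'I_(size s)) j : ok j (nth x0 s k) by exact: (oks (lift ord0 k) j).
rewrite -/(bethe s) exchange // (IH i l okl oks' gls gs).
under [X in _ + X = _]eq_bigr => j _ do rewrite (IH j m (okm j) oks' gms gs).
(* The term k = 0, which deletes [m], comes only from a swap at [m] followed by the diagonal part;
   the other terms delete an entry of the tail. *)
rewrite big_ord_recl /= dels0.
rewrite linearD linearZ /= scalerDr scalerA -!addrA; congr (_ + _).
  by congr (_ *: _); rewrite /bethe_weight big_cons mulrCA.
rewrite linear_sum scaler_sumr.
under [X in _ + X = _]eq_bigr => j _.
  rewrite linearD linearZ /= scalerDr scalerA linear_sum scaler_sumr /=.
over.
rewrite big_split /= addrCA; congr (_ + _).
  by rewrite scaler_suml; apply: eq_bigr => j _.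
rewrite exchange_big -big_split /=; apply: eq_bigr => k _.
set y := nth x0 s k.
have gly : good l y by exact: (all_nthP x0 gls).
have gmy : good m y by exact: (all_nthP x0 gms).
have oky j : ok j y by exact: oks'.
rewrite -[dels (bump 0 k) _]/(m :: dels k s) /=.
(* After exchanging B(m) and B(l), both routes that delete [y] end in the same vector, and only
   coefficients remain to be compared. *)
set w := dels k s; rewrite -/(bethe w) linearZ /= B_comm scalerA.
under [X in _ + X = _]eq_bigr => j _ do rewrite linearZ /= scalerA.
rewrite -scaler_suml -scalerDl; congr (_ *: _).
rewrite mulr_sumr; under [X in _ + X = _]eq_bigr => j _ do rewrite mulr_sumr.
rewrite exchange_big -big_split /=; apply: eq_bigr => j _.
rewrite /bethe_weight big_cons; under [X in _ + X = _]eq_bigr => j' _ do rewrite mulrA.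
rewrite -mulr_suml (mulrA (al i l m)) -mulrDl (cocycle _ okl) //.
by rewrite -mulrA; congr (_ * _); rewrite mulrCA.
Qed.

End BetheAnsatz.

(** * Operators acting on functions of configurations *)

Section Act.
Variables (R : realType) (I : finType).
Implicit Types (M N : Op R I) (f : I -> R[i]).

Definition act M f : I -> R[i] := fun x => \sum_y M x y * f y.

Lemma act_mul M N f : act (opmul M N) f = act M (act N f).
Proof.
apply/funext => x; rewrite /act.
under eq_bigr => y _ do rewrite /opmul mulr_suml.
rewrite exchange_big; apply: eq_bigr => z _.
by rewrite mulr_sumr; apply: eq_bigr => y _; rewrite mulrA.
Qed.

Lemma act_id f : act (@opid R I) f = f.
Proof.
apply/funext => x; rewrite /act (bigD1 x) //= /opid eqxx mul1r big1 ?addr0 //.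
by move=> y /negPf; rewrite eq_sym => ->; rewrite mul0r.
Qed.

Lemma act_big (J : Type) (s : seq J) (M : J -> Op R I) f :
  act (\big[@opmul R I/@opid R I]_(j <- s) M j) f = foldr (fun j => act (M j)) f s.
Proof.
by elim: s => [|j s IH]; rewrite ?big_nil ?act_id // big_cons act_mul IH.
Qed.

End Act.

(** * The monodromy matrix as a composition of sitewise operators *)

Section Sites.
Variables (R : realType) (L : nat) (g h : R[i]).
Implicit Types (j k : 'I_L) (t : conf L) (f : fconf L -> R[i]).

Definition upd t j (x : bool) : conf L := [ffun k => if k == j then x else t k].

Lemma upd_same t j x : upd t j x j = x.
Proof. by rewrite ffunE eqxx. Qed.

Lemma upd_neq t j k x : k != j -> upd t j x k = t k.
Proof. by rewrite ffunE => /negPf ->. Qed.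

Lemma upd_upd t j x y : upd (upd t j x) j y = upd t j y.
Proof. by apply/ffunP => k; rewrite !ffunE; case: eqP. Qed.

Lemma upd_id t j x : t j = x -> upd t j x = t.
Proof. by move=> <-; apply/ffunP => k; rewrite ffunE; case: eqP => [->|]. Qed.

Lemma updC t j k x y : j != k -> upd (upd t j x) k y = upd (upd t k y) j x.
Proof.
move=> njk; apply/ffunP => i; rewrite !ffunE.
by case: (eqVneq i j) => // ->; rewrite (negPf njk).
Qed.

(** A row of the six-vertex matrix has at most two non-zero entries: the diagonal one and the one
    exchanging the auxiliary state with that of site [j]. In this form local relations are finite
    case checks. *)
Definition Rop (u : R[i]) j f : fconf L -> R[i] := fun p =>
  if p.1 == p.2 j then wa g u * f p
  else wb u * f p + wc g * f (p.2 j, upd p.2 j p.1).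

Definition Kop (u : R[i]) f : fconf L -> R[i] := fun p =>
  (if p.1 then csinh (h - u) else csinh (h + u)) * f p.

Lemma act_K0 u f : act (@K0 R L h u) f = Kop u f.
Proof.
apply/funext => p; rewrite /act (bigD1 p) //= /K0 eqxx big1 ?addr0 //.
by move=> q /negPf; rewrite eq_sym => ->; rewrite mul0r.
Qed.

Lemma act_R0j u j f : act (R0j g u j) f = Rop u j f.
Proof.
apply/funext => -[a t]; rewrite /act /Rop /=.
have R0j0 (q : fconf L) : q != (a, t) -> q != (t j, upd t j a) ->
    R0j g u j (a, t) q = 0.
  case: q => b t' /= n1 n2; rewrite /R0j /=.
  case: ifP => [/forallP tt'|]; last by rewrite mulr0.
  have tE : t' = upd t j (t' j).
    apply/ffunP => k; rewrite ffunE; have := tt' k.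
    by case: eqVneq => [->|_ /= /eqP].
  rewrite mulr1 /Rent; case: ifP => [/andP[/eqP ab /eqP tj]|_].
    by rewrite {}tE -tj upd_id // -ab eqxx in n1.
  case: ifP => // /andP[/eqP aj /eqP bj].
  by rewrite tE -aj bj eqxx in n2.
have R0jd : R0j g u j (a, t) (a, t) = if a == t j then wa g u else wb u.
  rewrite /R0j /Rent /= !eqxx /=.
  by case: forallP => [_|[]]; rewrite ?mulr1 // => k; rewrite eqxx implybT.
case: eqVneq => [aj|naj].
  rewrite (bigD1 (a, t)) //= R0jd {1}aj eqxx big1 ?addr0 // => q nq.
  by rewrite R0j0 ?mul0r // -aj upd_id.
have nq : (t j, upd t j a) != (a, t) by apply: contra naj => /eqP[->].
rewrite (bigD1 (a, t)) //= (bigD1 (t j, upd t j a)) //= R0jd (negPf naj).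
rewrite big1 ?addr0 => [|q /andP[n1 n2]]; last by rewrite R0j0 ?mul0r.
congr (_ + _ * _); rewrite /R0j /Rent /= upd_same (negPf naj) !eqxx /=.
case: forallP => [_|[]]; rewrite ?mulr1 // => k.
by apply/implyP => nkj; rewrite upd_neq.
Qed.

Definition Top (mu : 'I_L -> R[i]) (l : R[i]) (s : seq 'I_L) f : fconf L -> R[i] :=
  foldr (fun j => Rop (l - mu j) j)
        (Kop l (foldr (fun j => Rop (l + mu j) j) f s)) (rev s).

Lemma act_monodromy mu l f :
  act (monodromy g h mu l) f = Top mu l (enum 'I_L) f.
Proof.
rewrite /monodromy !act_mul !act_big act_K0 /Top.
have E v s f' : foldr (fun j : 'I_L => act (R0j g (v j) j)) f' s =
    foldr (fun j => Rop (v j) j) f' s.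
  by elim: s => //= j s ->; rewrite act_R0j.
by rewrite (E (fun j => l + mu j)) (E (fun j => l - mu j)).
Qed.

(** A new last site dresses the smaller operator from both sides; hence the inductions on sites by
    [last_ind]. *)
Lemma Top_rcons mu l s j f :
  Top mu l (rcons s j) f = Rop (l - mu j) j (Top mu l s (Rop (l + mu j) j f)).
Proof. by rewrite /Top rev_rcons foldr_rcons. Qed.

End Sites.

(** * Yang-Baxter and reflection equations *)

Section Reflection.
Variables (R : realType) (L : nat) (g h : R[i]).
Implicit Types (j k : 'I_L) (t : conf L) (f : fconf L -> R[i]).
Local Notation vec3 := (bool -> bool -> conf L -> R[i]).
Implicit Types (psi : vec3).
Local Notation Rj := (@Rop R L g).
Local Notation Kh := (@Kop R L h).
Local Notation Tm := (@Top R L g h).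

(** The Boolean arguments of a [vec3] index the two copies of the auxiliary space in the reflection
    equation. *)
Definition lift1 (X : (fconf L -> R[i]) -> fconf L -> R[i]) psi : vec3 :=
  fun a b t => X (fun p => psi p.1 b p.2) (a, t).

Definition lift2 (X : (fconf L -> R[i]) -> fconf L -> R[i]) psi : vec3 :=
  fun a b t => X (fun p => psi a p.1 p.2) (b, t).

Definition R12 (u : R[i]) psi : vec3 := fun a b t =>
  if a == b then wa g u * psi a b t else wb u * psi a b t + wc g * psi b a t.

Lemma funext3 (psi psi' : vec3) : (forall a b t, psi a b t = psi' a b t) -> psi = psi'.
Proof. by move=> E; do 3 apply/funext => ?; apply: E. Qed.

Ltac site_cases t j :=
  let E := fresh "E" in case E : (t j);
  rewrite /lift1 /lift2 /R12 /Rop /= ?upd_same ?E /= ?upd_same ?upd_upd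
    ?(upd_id E) /= ?upd_upd ?(upd_id E) /wa /wb /wc.

(** Two arrangements of the Yang-Baxter equation are used: this one carries site operators past
    R12(l + m), and [yang_baxter] past R12(l - m). *)
Lemma yang_baxter_mid j (u w : R[i]) psi :
  lift1 (Rj u j) (R12 (u + w) (lift2 (Rj w j) psi)) =
  lift2 (Rj w j) (R12 (u + w) (lift1 (Rj u j) psi)).
Proof.
apply: funext3 => a b t; site_cases t j; case: a; case: b => /=;
  rewrite ?upd_same ?upd_upd ?(upd_id E) /=; trig_field.
Qed.

Lemma yang_baxter j (u w : R[i]) psi :
  R12 u (lift1 (Rj (u + w) j) (lift2 (Rj w j) psi)) =
  lift2 (Rj w j) (lift1 (Rj (u + w) j) (R12 u psi)).
Proof.
apply: funext3 => a b t; site_cases t j; case: a; case: b => /=;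
  rewrite ?upd_same ?upd_upd ?(upd_id E) /=; trig_field.
Qed.

Lemma reflection_K (l m : R[i]) psi :
  R12 (l - m) (lift1 (Kh l) (R12 (l + m) (lift2 (Kh m) psi))) =
  lift2 (Kh m) (R12 (l + m) (lift1 (Kh l) (R12 (l - m) psi))).
Proof.
apply: funext3 => a b t; rewrite /lift1 /lift2 /R12 /Kop /wa /wb /wc.
by case: a; case: b => /=; trig_field.
Qed.

Lemma Rop_comm12 j k (u w : R[i]) psi : j != k ->
  lift1 (Rj u j) (lift2 (Rj w k) psi) = lift2 (Rj w k) (lift1 (Rj u j) psi).
Proof.
move=> njk; apply: funext3 => a b t; rewrite /lift1 /lift2 /Rop /=.
have nkj : k != j by rewrite eq_sym.
rewrite !(upd_neq _ _ njk) !(upd_neq _ _ nkj) (updC _ _ _ njk).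
by case: (a == t j); case: (b == t k) => /=; ring.
Qed.

Lemma Kop_comm1 k (u w : R[i]) psi :
  lift1 (Kh u) (lift2 (Rj w k) psi) = lift2 (Rj w k) (lift1 (Kh u) psi).
Proof.
apply: funext3 => a b t; rewrite /lift1 /lift2 /Rop /Kop /=.
by case: a; case: (b == t k) => /=; ring.
Qed.

Lemma Kop_comm2 k (u w : R[i]) psi :
  lift2 (Kh u) (lift1 (Rj w k) psi) = lift1 (Rj w k) (lift2 (Kh u) psi).
Proof.
apply: funext3 => a b t; rewrite /lift1 /lift2 /Rop /Kop /=.
by case: b; case: (a == t k) => /=; ring.
Qed.

Lemma lift1_rcons mu l s j psi :
  lift1 (Tm mu l (rcons s j)) psi =
  lift1 (Rj (l - mu j) j) (lift1 (Tm mu l s) (lift1 (Rj (l + mu j) j) psi)).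
Proof.
by apply: funext3 => a b t; rewrite /lift1 Top_rcons.
Qed.

Lemma lift2_rcons mu l s j psi :
  lift2 (Tm mu l (rcons s j)) psi =
  lift2 (Rj (l - mu j) j) (lift2 (Tm mu l s) (lift2 (Rj (l + mu j) j) psi)).
Proof.
by apply: funext3 => a b t; rewrite /lift2 Top_rcons.
Qed.

Lemma Top_comm1 mu l s k (w : R[i]) psi : k \notin s ->
  lift1 (Tm mu l s) (lift2 (Rj w k) psi) = lift2 (Rj w k) (lift1 (Tm mu l s) psi).
Proof.
elim/last_ind: s psi => [|s j IH] psi; first by move=> _; apply: Kop_comm1.
rewrite mem_rcons inE negb_or eq_sym => /andP[njk ks].
by rewrite !lift1_rcons Rop_comm12 // IH // Rop_comm12.
Qed.

Lemma Top_comm2 mu l s k (w : R[i]) psi : k \notin s ->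
  lift2 (Tm mu l s) (lift1 (Rj w k) psi) = lift1 (Rj w k) (lift2 (Tm mu l s) psi).
Proof.
elim/last_ind: s psi => [|s j IH] psi; first by move=> _; apply: Kop_comm2.
rewrite mem_rcons inE negb_or => /andP[nkj ks].
by rewrite !lift2_rcons -Rop_comm12 // IH // Rop_comm12.
Qed.

(** Sklyanin's dressing argument. The operators of the new site [j] are moved through each R12 by
    Yang-Baxter and through the smaller double-row operator of the other auxiliary space by
    commutation, as [j] is not in [s]. *)
Lemma reflection mu (l m : R[i]) s psi : uniq s ->
  R12 (l - m) (lift1 (Tm mu l s) (R12 (l + m) (lift2 (Tm mu m s) psi))) =
  lift2 (Tm mu m s) (R12 (l + m) (lift1 (Tm mu l s) (R12 (l - m) psi))).
Proof.
elim/last_ind: s psi => [|s j IH] psi; first by move=> _; apply: reflection_K.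
rewrite rcons_uniq => /andP[js us]; rewrite !lift1_rcons !lift2_rcons.
(* The splittings of the spectral parameters that match the two arrangements of Yang-Baxter. *)
have e1 : l + m = (l + mu j) + (m - mu j) by ring.
have e2 : l + m = (l - mu j) + (m + mu j) by ring.
have e3 : l - mu j = (l - m) + (m - mu j) by ring.
have e4 : l + mu j = (l - m) + (m + mu j) by ring.
rewrite {1}e1 yang_baxter_mid -e1 Top_comm1 // {1}e3 yang_baxter -e3.
rewrite -(Top_comm2 _ _ _ _ js) IH // {1}e4 yang_baxter -e4.
rewrite (Top_comm1 _ _ _ _ js) -(Top_comm2 _ _ _ _ js).
by rewrite {1}e2 yang_baxter_mid -e2.
Qed.

End Reflection.

(** * Exchange relations *)

Section ActLinear.
Variables (R : realType) (I : finType) (M : Op R I).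
Implicit Types (f : I -> R[i]).

Lemma actD f1 f2 : act M (fun x => f1 x + f2 x) = fun x => act M f1 x + act M f2 x.
Proof.
apply/funext => x; rewrite /act -big_split.
by apply: eq_bigr => y _; rewrite /= mulrDr.
Qed.

Lemma actZ (p : R[i]) f : act M (fun x => p * f x) = fun x => p * act M f x.
Proof.
apply/funext => x; rewrite /act mulr_sumr.
by apply: eq_bigr => y _; rewrite mulrCA.
Qed.

Lemma act0 : act M (fun _ => 0) = fun _ => 0.
Proof. by apply/funext => x; rewrite /act big1 // => y _; rewrite mulr0. Qed.

End ActLinear.

Section Exchange.
Variables (R : realType) (L : nat) (g h : R[i]) (mu : 'I_L -> R[i]).
Implicit Types (l m : R[i]) (v : conf L -> R[i]) (psi : bool -> bool -> conf L -> R[i]).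

Definition blk (a b : bool) l : Op R (conf L) :=
  fun s t => monodromy g h mu l (a, s) (b, t).

Local Notation T l := (Top g h mu l (enum 'I_L)).
Local Notation A l := (act (Aop g h mu l)).
Local Notation B l := (act (Bop g h mu l)).
Local Notation D l := (act (Dop g h mu l)).

Lemma Top_blk l (f : fconf L -> R[i]) a t :
  T l f (a, t) = act (blk a true l) (fun s => f (true, s)) t
               + act (blk a false l) (fun s => f (false, s)) t.
Proof.
rewrite -act_monodromy.
transitivity (\sum_(b : bool) \sum_s monodromy g h mu l (a, t) (b, s) * f (b, s)).
  by rewrite pair_bigA; apply: eq_bigr => -[].
by rewrite big_bool.
Qed.

Lemma lift1_blk l psi a b : lift1 (T l) psi a b =
  fun t => act (blk a true l) (psi true b) t + act (blk a false l) (psi false b) t.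
Proof. by apply/funext => t; rewrite /lift1 Top_blk. Qed.

Lemma lift2_blk l psi a b : lift2 (T l) psi a b =
  fun t => act (blk b true l) (psi a true) t + act (blk b false l) (psi a false) t.
Proof. by apply/funext => t; rewrite /lift2 Top_blk. Qed.

Definition delta2 (c1 c2 : bool) v : bool -> bool -> conf L -> R[i] :=
  fun a b => if (a == c1) && (b == c2) then v else fun _ => 0.

(** [delta2] selects a column and [a b] a row, so each choice of indices gives one quadratic
    relation between A, B, C and D. *)
Lemma reflection_blk l m a b c1 c2 v t :
  R12 g (l - m) (lift1 (T l) (R12 g (l + m) (lift2 (T m) (delta2 c1 c2 v)))) a b t =
  lift2 (T m) (R12 g (l + m) (lift1 (T l) (R12 g (l - m) (delta2 c1 c2 v)))) a b t.
Proof. by rewrite reflection // enum_uniq. Qed.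

Let blkA l : blk false false l = Aop g h mu l. Proof. by []. Qed.
Let blkB l : blk false true l = Bop g h mu l. Proof. by []. Qed.
Let blkD l : blk true true l = Dop g h mu l. Proof. by []. Qed.

(** The extracted component is the wanted relation up to rearrangement, which [ring] checks; the two
    variants differ by the overall sign. *)
Let eq_of_sub (x y a b : R[i]) : a = b -> x - y = b - a -> x = y.
Proof. by move=> ->; rewrite subrr => /subr0_eq. Qed.

Let eq_of_sub' (x y a b : R[i]) : a = b -> x - y = a - b -> x = y.
Proof. by move=> ->; rewrite subrr => /subr0_eq. Qed.

Ltac components := rewrite /R12 /= ?lift1_blk ?lift2_blk /= ?lift1_blk ?lift2_blk /delta2 /=
  ?(actD, actZ, act0) ?(blkA, blkB, blkD).

Lemma exchange_AB l m v t :
  wb (m - l) * wa g (m + l) * A l (B m v) t =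
  wa g (m - l) * wb (m + l) * B m (A l v) t - wc g * wb (m + l) * B l (A m v) t
  - wc g * wb (m - l) * B l (D m v) t.
Proof.
have := reflection_blk m l false false true false v t.
by components => /eq_of_sub; apply; ring.
Qed.

(** Not yet ordered: A still stands to the left of B in two terms. *)
Lemma exchange_DB0 l m v t :
  wb (l - m) * wb (l + m) * D l (B m v) t + wc g * wa g (l + m) * B l (D m v) t
    + wc g * wc g * A l (B m v) t
  = wa g (l - m) * wa g (l + m) * B m (D l v) t + wa g (l - m) * wc g * A m (B l v) t.
Proof.
have := reflection_blk l m true false true true v t.
by components => /eq_of_sub'; apply; ring.
Qed.

Lemma exchange_BB0 l m v t :
  wa g (l - m) * wb (l + m) * B l (B m v) t = wa g (l - m) * wb (l + m) * B m (B l v) t.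
Proof.
have := reflection_blk l m false false true true v t.
by components => /eq_of_sub'; apply; ring.
Qed.

(* Substitute exchange_AB, for (l, m) and for (m, l), into exchange_DB0. *)
Lemma exchange_DB1 l m v t :
  wb (l - m) * wb (l + m) * (wb (l - m) * wa g (l + m) * D l (B m v) t) =
  wb (l - m) * wb (l + m) *
   (wa g (l - m) * wa g (l + m + g) * B m (D l v) t
    - wc g * wa g (l + m + g) * B l (D m v) t
    - wc g * wb (2 * g) * B m (A l v) t
    + wc g * wa g (l - m + g) * B l (A m v) t).
Proof.
have e0 := exchange_DB0 l m v t.
have e1 := exchange_AB l m v t.
have e2 := exchange_AB m l v t.
have eD : wb (l - m) * wb (l + m) * D l (B m v) t =
  wa g (l - m) * wa g (l + m) * B m (D l v) t + wa g (l - m) * wc g * A m (B l v) t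
  - (wc g * wa g (l + m) * B l (D m v) t + wc g * wc g * A l (B m v) t).
  by rewrite -e0; ring.
rewrite mulrCA eD.
transitivity (wb (l - m) * wa g (l + m) * (wa g (l - m) * wa g (l + m) * B m (D l v) t)
  - wb (l - m) * wa g (l + m) * (wc g * wa g (l + m) * B l (D m v) t)
  + wa g (l - m) * wc g * (wb (l - m) * wa g (l + m) * A m (B l v) t)
  + wc g * wc g * (wb (m - l) * wa g (m + l) * A l (B m v) t)).
  have -> : wb (m - l) = - wb (l - m) by trig_field.
  by rewrite [m + l]addrC; ring.
rewrite e1 e2; trig_field.
Qed.

End Exchange.

(** * Cancellation of vanishing factors *)

Section Laurent.
Variable R : realType.
Implicit Types (f d : R[i] -> R[i]) (p : {poly R[i]}).

(** Negative powers of exp(z) are cleared so that cancellation takes place in a polynomial ring,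
    which is an integral domain. *)
Definition laurent f :=
  exists N p, forall z, cexp z ^+ N * f z = p.[cexp z].

Lemma cexp_real (x : R) : cexp x%:C = (expR x)%:C.
Proof. by rewrite /= cos0 sin0 mulr1 mulr0. Qed.

(** The exponential is injective on the naturals, which provides [size p] distinct roots, too many
    for a non-zero [p]. *)
Lemma poly_cexp_eq0 p : (forall z, p.[cexp z] = 0) -> p = 0.
Proof.
move=> p0; apply/eqP; apply: contraT => pn0.
pose s := [seq @cexp R k%:R%:C | k <- iota 0 (size p)].
have us : uniq s.
  rewrite map_inj_uniq ?iota_uniq // => i j.
  by rewrite !cexp_real => -[/expR_inj/eqP]; rewrite eqr_nat => /eqP.
have rs : all (root p) s by apply/allP => _ /mapP[k _ ->]; apply/eqP/p0.
by have := max_poly_roots pn0 rs us; rewrite size_map size_iota ltnn.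
Qed.

(** One point where [d] is non-zero makes its polynomial non-zero, so that of [f] is zero; thus [f]
    vanishes even at the zeros of [d]. *)
Lemma laurent_cancel d f z0 : laurent d -> laurent f -> d z0 != 0 ->
  (forall z, d z * f z = 0) -> forall z, f z = 0.
Proof.
move=> [M [p dp]] [N [q fq]] dz0 df0.
have pq0 : p * q = 0.
  apply: poly_cexp_eq0 => z.
  by rewrite hornerM -dp -fq mulrACA df0 mulr0.
have pn0 : p != 0.
  apply: contra dz0 => /eqP p0; have := dp z0.
  by rewrite p0 horner0 => /eqP; rewrite mulf_eq0 expf_eq0 (negPf (cexp_neq0 _)) andbF.
have q0 : q = 0 by move/eqP: pq0; rewrite mulf_eq0 (negPf pn0) => /eqP.
move=> z; have := fq z.
by rewrite q0 horner0 => /eqP; rewrite mulf_eq0 expf_eq0 (negPf (cexp_neq0 _)) andbF => /eqP.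
Qed.

Lemma laurent_const c : laurent (fun _ => c).
Proof. by exists 0%N, c%:P => z; rewrite hornerC mul1r. Qed.

Lemma laurentD f1 f2 : laurent f1 -> laurent f2 -> laurent (fun z => f1 z + f2 z).
Proof.
move=> [M [p fp]] [N [q fq]]; exists (M + N)%N, ('X^N * p + 'X^M * q) => z.
by rewrite !hornerE -fp -fq exprD; ring.
Qed.

Lemma laurentM f1 f2 : laurent f1 -> laurent f2 -> laurent (fun z => f1 z * f2 z).
Proof.
move=> [M [p fp]] [N [q fq]]; exists (M + N)%N, (p * q) => z.
by rewrite hornerM -fp -fq exprD mulrACA.
Qed.

Lemma laurentN f : laurent f -> laurent (fun z => - f z).
Proof.
by move=> [N [p fp]]; exists N, (- p) => z; rewrite hornerN -fp mulrN.
Qed.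

Lemma laurent_sum (I : Type) (s : seq I) (F : I -> R[i] -> R[i]) :
  (forall i, laurent (F i)) -> laurent (fun z => \sum_(i <- s) F i z).
Proof.
move=> lF; elim: s => [|i s IH].
  by under eq_fun do rewrite big_nil; apply: laurent_const.
by under eq_fun do rewrite big_cons; apply: laurentD.
Qed.

Lemma laurent_csinhD (u : R[i]) : laurent (fun z => csinh (z + u)).
Proof.
exists 1%N, ((cexp u / 2)%:P * 'X^2 - ((cexp u)^-1 / 2)%:P) => z.
by rewrite !hornerE /=; trig_field.
Qed.

Lemma laurent_csinhDD (u w : R[i]) : laurent (fun z => csinh (z + u + w)).
Proof.
rewrite (_ : (fun z => _) = fun z => csinh (z + (u + w))); first exact: laurent_csinhD.
by apply/funext => z; rewrite addrA.
Qed.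

Lemma laurent_csinhDDD (u v w : R[i]) : laurent (fun z => csinh (z + u + v + w)).
Proof.
rewrite (_ : (fun z => _) = fun z => csinh (z + (u + v) + w)).
  exact: laurent_csinhDD.
by apply/funext => z; rewrite addrA.
Qed.

Lemma laurent_csinhB (u : R[i]) : laurent (fun z => csinh (u - z)).
Proof.
exists 1%N, ((cexp u / 2)%:P - ((cexp u)^-1 / 2)%:P * 'X^2) => z.
by rewrite !hornerE /=; trig_field.
Qed.

Lemma csinh1_neq0 : csinh (1 : R[i]) != 0.
Proof.
rewrite -[1]/(1%:C) /= cos0 sin0 mulr1 mulr0 /rsinh.
apply/eqP => -[/eqP]; rewrite mulf_eq0 invr_eq0 pnatr_eq0 orbF subr_eq0.
by move=> /eqP/expR_inj/eqP; rewrite -subr_eq0 opprK (pnatr_eq0 _ 2).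
Qed.

Section Ops.
Variable I : finType.
Implicit Types M : R[i] -> Op R I.

Definition laurent_op M := forall x y, laurent (fun z => M z x y).

Lemma laurent_opmul M N : laurent_op M -> laurent_op N ->
  laurent_op (fun z => opmul (M z) (N z)).
Proof. by move=> lM lN x y; apply: laurent_sum => w; apply: laurentM. Qed.

Lemma laurent_big (J : Type) (s : seq J) (M : J -> R[i] -> Op R I) :
  (forall j, laurent_op (M j)) ->
  laurent_op (fun z => \big[@opmul R I/@opid R I]_(j <- s) M j z).
Proof.
move=> lM; elim: s => [|j s IH].
  by under eq_fun do rewrite big_nil; move=> x y; apply: laurent_const.
by under eq_fun do rewrite big_cons; apply: laurent_opmul.
Qed.

Lemma laurent_act M (f : R[i] -> I -> R[i]) x : laurent_op M ->
  (forall y, laurent (fun z => f z y)) -> laurent (fun z => act (M z) (f z) x).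
Proof. by move=> lM lf; apply: laurent_sum => y; apply: laurentM. Qed.

End Ops.

Section Monodromy.
Variables (L : nat) (g h : R[i]) (mu : 'I_L -> R[i]).

Lemma laurent_R0j u j : laurent_op (fun z => @R0j R L g (z + u) j).
Proof.
move=> p q; apply: laurentM; last exact: laurent_const.
rewrite /Rent /wa /wb; case: (_ && _); last by case: (_ && _); apply: laurent_const.
by case: (_ == _); [apply: laurent_csinhDD | apply: laurent_csinhD].
Qed.

Lemma laurent_monodromy : laurent_op (monodromy g h mu).
Proof.
apply: laurent_opmul; last by apply: laurent_big => j; apply: laurent_R0j.
apply: laurent_opmul; first by apply: laurent_big => j; apply: laurent_R0j.
move=> p q; rewrite /K0; case: (p == q); last exact: laurent_const.
case: p.1; first exact: laurent_csinhB.
rewrite (_ : (fun z => _) = fun z => csinh (z + h)); first exact: laurent_csinhD.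
by apply/funext => z; rewrite addrC.
Qed.

Local Notation A l := (act (Aop g h mu l)).
Local Notation B l := (act (Bop g h mu l)).
Local Notation D l := (act (Dop g h mu l)).

Lemma laurent_cancel_sinh u1 u2 f : laurent f ->
  (forall z, csinh (z + u1) * csinh (z + u2) * f z = 0) -> forall z, f z = 0.
Proof.
(* The point z = 1 - u is a witness that sinh(z + u) is not identically zero. *)
have nz (u : R[i]) : csinh (1 - u + u) != 0 by rewrite subrK; exact: csinh1_neq0.
move=> lf f0; apply: (laurent_cancel (laurent_csinhD u2) lf (nz u2)).
apply: (laurent_cancel (laurent_csinhD u1) _ (nz u1)) => [|z].
  by apply: laurentM => //; apply: laurent_csinhD.
by rewrite mulrA.
Qed.

Let laurent_A : laurent_op (Aop g h mu).
Proof. by move=> x y; apply: laurent_monodromy. Qed.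

Let laurent_B : laurent_op (Bop g h mu).
Proof. by move=> x y; apply: laurent_monodromy. Qed.

Let laurent_D : laurent_op (Dop g h mu).
Proof. by move=> x y; apply: laurent_monodromy. Qed.

Let laurent_act1 M (v : conf L -> R[i]) t :
  laurent_op M -> laurent (fun z => act (M z) v t).
Proof. by move=> lM; apply: laurent_act => // y; apply: laurent_const. Qed.

Let laurent_act2 (M : Op R (conf L)) N (v : conf L -> R[i]) t :
  laurent_op N -> laurent (fun z => act M (act (N z) v) t).
Proof.
move=> lN; apply: (@laurent_act _ (fun=> M)) => [x y|y]; first exact: laurent_const.
exact: laurent_act1.
Qed.

(** With [m] fixed, the factor a(l - m) b(l + m) of [exchange_BB0] is cancelled as a Laurent
    polynomial in exp(l), so no genericity is assumed. *)
Lemma exchange_BB l m v : B l (B m v) = B m (B l v).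
Proof.
apply/funext => t; apply: subr0_eq; move: l.
apply: (@laurent_cancel_sinh (- m + g) m) => [|l].
  by apply: laurentD; [apply: laurent_act1|apply/laurentN/laurent_act2].
by rewrite mulrBr addrA [_ * _ * _]exchange_BB0 subrr.
Qed.

(** The factor b(l - m) b(l + m) of [exchange_DB1] is cancelled in the same way; the later predicate
    [good] does not exclude b(l + m) = 0. *)
Lemma exchange_DB l m v t :
  wb (l - m) * wa g (l + m) * D l (B m v) t =
   wa g (l - m) * wa g (l + m + g) * B m (D l v) t
    - wc g * wa g (l + m + g) * B l (D m v) t
    - wc g * wb (2 * g) * B m (A l v) t
    + wc g * wa g (l - m + g) * B l (A m v) t.
Proof.
apply: subr0_eq; move: l; apply: (@laurent_cancel_sinh (- m) m) => [|l].
  rewrite /wa /wb /wc.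
  have lc : laurent (fun _ => csinh g) := laurent_const _.
  repeat first [exact: laurent_const | exact: laurent_csinhD | exact: laurent_csinhDD | exact: laurent_csinhDDD | exact: laurent_act1 | exact: laurent_act2
    | apply: laurentN | apply: laurentM | apply: laurentD ].
by rewrite mulrBr -/(wb _) -/(wb _) exchange_DB1 subrr.
Qed.

End Monodromy.
End Laurent.

(** * Action on the reference state *)

Section Vacuum.
Variables (R : realType) (L : nat) (g h : R[i]) (mu : 'I_L -> R[i]) (l : R[i]).
Implicit Types (j k : 'I_L) (t : conf L) (f : fconf L -> R[i]) (s : seq 'I_L).
Local Notation Rj := (@Rop R L g).
Local Notation T := (Top g h mu l).

Lemma Rop_lin u j (c1 c2 : R[i]) f1 f2 :
  Rj u j (fun p => c1 * f1 p + c2 * f2 p) =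
  fun p => c1 * Rj u j f1 p + c2 * Rj u j f2 p.
Proof. by apply/funext => p; rewrite /Rop; case: ifP => _; ring. Qed.

Lemma Top_lin s (c1 c2 : R[i]) f1 f2 :
  T s (fun p => c1 * f1 p + c2 * f2 p) = fun p => c1 * T s f1 p + c2 * T s f2 p.
Proof.
elim/last_ind: s f1 f2 => [|s j IH] f1 f2.
  by apply/funext => p; rewrite /Top /= /Kop; ring.
by rewrite Top_rcons Rop_lin IH Rop_lin -!Top_rcons.
Qed.

Lemma TopZ s (c : R[i]) f : T s (fun p => c * f p) = fun p => c * T s f p.
Proof.
rewrite (_ : (fun p => c * f p) = fun p => c * f p + 0 * f p); last first.
  by apply/funext => p; rewrite mul0r addr0.
by rewrite Top_lin; apply/funext => p; rewrite mul0r addr0.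
Qed.

Definition vacA s : R[i] :=
  wb (h + l) * \prod_(j <- s) (wa g (l - mu j) * wa g (l + mu j)).

Definition vacD s : R[i] := - (wb (2 * l) / wa g (2 * l)) * wa g (l - h) *
  \prod_(j <- s) (wb (l - mu j) * wb (l + mu j)).

(* R acts as the scalar a on e_1 (x) e_1 *)
Lemma Rop_low u k f : (forall p : fconf L, p.1 || p.2 k -> f p = 0) ->
  Rj u k f = fun p => wa g u * f p.
Proof.
move=> f0; apply/funext => -[a t]; rewrite /Rop /=; case: eqVneq => // nat'.
have at' : a || t k by move: nat'; case: a; case: (t k).
by rewrite !f0 ?mulr0 ?addr0 //= upd_same orbC.
Qed.

(** Every R acts by its entry a, and K by sinh(h + l). Sites outside [s] are left free, so that the
    lemma applies to [low_flip j]. *)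
Lemma Top_low s f : (forall p : fconf L, p.1 -> f p = 0) ->
  (forall k (p : fconf L), k \in s -> p.2 k -> f p = 0) -> T s f = fun p => vacA s * f p.
Proof.
move=> f0; elim/last_ind: s => [|s j IH] fs.
  apply/funext => -[a t]; rewrite /Top /Kop /= /vacA big_nil mulr1.
  by case: a => //; rewrite f0 ?mulr0.
have fj (p : fconf L) : p.1 || p.2 j -> f p = 0.
  by case/orP; [apply: f0 | apply: fs; rewrite mem_rcons mem_head].
rewrite Top_rcons (Rop_low _ fj).
rewrite TopZ IH => [|k p ks]; last by apply: fs; rewrite mem_rcons inE ks orbT.
apply/funext => p; rewrite Rop_low => [|q fq]; last by rewrite fj ?mulr0.
by rewrite /vacA -cats1 big_cat big_seq1 /=; ring.
Qed.

Lemma Top_local s k f : k \notin s -> (forall a (t : conf L), t k -> f (a, t) = 0) ->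
  forall a (t : conf L), t k -> T s f (a, t) = 0.
Proof.
elim/last_ind: s f => [|s j IH] f.
  by move=> _ f0 a t tk; rewrite /Top /Kop /= f0 ?mulr0.
rewrite mem_rcons inE negb_or => /andP[nkj ks] f0 a t tk.
have Rop0 u f' : (forall a (t : conf L), t k -> f' (a, t) = 0) ->
    forall a (t : conf L), t k -> Rj u j f' (a, t) = 0.
  move=> f'0 a' t' tk'; rewrite /Rop /=.
  by case: ifP => _; rewrite !f'0 ?mulr0 ?addr0 // upd_neq.
by rewrite Top_rcons; apply: (Rop0) => //; apply: IH => //; apply: Rop0.
Qed.

(** The vector e_2 (x) |0>, and below it the one obtained by exchanging the auxiliary state with
    site [j]. *)
Definition up_vac (p : fconf L) : R[i] := (p.1 && (p.2 == vac L))%:R.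
Definition low_flip j (p : fconf L) : R[i] := (~~ p.1 && (p.2 == upd (vac L) j true))%:R.

Lemma upd_flip t j x y : t j = x -> (upd t j y == upd (vac L) j y) = (t == upd (vac L) j x).
Proof.
move=> tj; apply/eqP/eqP => [E|->]; last by rewrite upd_upd.
by rewrite -(upd_id tj) -[upd t j x](upd_upd _ _ y) E upd_upd.
Qed.

Lemma vac_upd j : upd (vac L) j false = vac L.
Proof. by apply: upd_id; rewrite ffunE. Qed.

Lemma Rop_up_vac u j :
  Rj u j up_vac = fun p => wb u * up_vac p + wc g * low_flip j p.
Proof.
apply/funext => -[a t]; rewrite /Rop /up_vac /low_flip /=.
case E : (t j); case: a => /=; rewrite ?mulr0 ?addr0 //.
- by case: eqP E => [->|_]; rewrite ?ffunE ?mulr0.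
- by rewrite -(upd_flip false E) vac_upd add0r.
- rewrite add0r; case: eqP E => [->|_]; rewrite ?upd_same ?mulr0 //.
Qed.

Hypothesis a2l : wa g (2 * l) != 0.

(** A new site multiplies the part (c / a(2 l)) [vacA] by b b and adds c^2 [vacA], from two
    exchanges at that site; together they restore the factor a a. *)
Lemma vac_step (v : R[i]) :
  wb (l - v) * wb (l + v) * (wc g / wa g (2 * l)) + wc g * wc g =
  wc g / wa g (2 * l) * (wa g (l - v) * wa g (l + v)).
Proof.
have := csinh_cexp_neq0 a2l; rewrite cexpD cexp2 => n.
by trig_field; rewrite n.
Qed.

Lemma vac_base : csinh (h - l) =
  - (wb (2 * l) / wa g (2 * l)) * wa g (l - h) + wc g / wa g (2 * l) * wb (h + l).
Proof.
have := csinh_cexp_neq0 a2l; rewrite cexpD cexp2 => n.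
by trig_field; rewrite n.
Qed.

Lemma Top_up_vac s t : uniq s ->
  T s up_vac (true, t) = (vacD s + wc g / wa g (2 * l) * vacA s) * (t == vac L)%:R.
Proof.
elim/last_ind: s t => [|s j IH] t.
  by move=> _; rewrite /Top /Kop /vacD /vacA !big_nil !mulr1 /= -vac_base.
rewrite rcons_uniq => /andP[js us]; rewrite Top_rcons Rop_up_vac Top_lin.
have TJ : T s (low_flip j) = fun p => vacA s * low_flip j p.
  apply: Top_low => [[a t'] /= ->|k [a t'] ks] //=; rewrite /low_flip /=.
  case: eqP => [->|]; last by rewrite andbF.
  by rewrite upd_neq ?ffunE //; apply: contraNneq js => <-.
rewrite /Rop TJ /= IH //.
case E : (t j) => /=.
  rewrite (_ : t == vac L = false) ?mulr0 ?mul0r ?addr0 ?mulr0 //.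
  by apply: contraTF E => /eqP ->; rewrite ffunE.
(* [up_vac] vanishes where site [j] is flipped, and the operator over [s] does not touch that
   site. *)
rewrite (Top_local js) ?upd_same //; last first.
  by move=> a t' t'j; rewrite /up_vac /=; case: eqP t'j => [->|]; rewrite ?ffunE ?andbF.
rewrite /low_flip /= (upd_flip true E) vac_upd.
rewrite /vacD /vacA -cats1 !big_cat !big_seq1 /=.
have st := vac_step (mu j); apply: subr0_eq.
set pa := \prod_(i <- s) (wa g (l - mu i) * wa g (l + mu i)).
(* The [vacD] parts agree factor by factor; the difference is a multiple of [vac_step]. *)
transitivity (wb (h + l) * pa * (t == vac L)%:R *
  (wb (l - mu j) * wb (l + mu j) * (wc g / wa g (2 * l)) + wc g * wc g
   - wc g / wa g (2 * l) * (wa g (l - mu j) * wa g (l + mu j)))).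
  by ring.
by rewrite st subrr mulr0.
Qed.

Definition vacv (t : conf L) : R[i] := (t == vac L)%:R.

Lemma Aop_vac t : act (Aop g h mu l) vacv t = LamA g h mu l * vacv t.
Proof.
pose f (p : fconf L) : R[i] := (~~ p.1 && (p.2 == vac L))%:R.
have := Top_blk g h mu l f false t.
have -> : (fun s : conf L => f (true, s)) = fun _ => 0 by [].
rewrite act0 add0r => <-; rewrite Top_low; first by rewrite /vacA big_enum.
  by case=> -[].
move=> k [a t'] _ /= tk; rewrite /f /=.
by case: eqP tk => [->|]; rewrite ?ffunE ?andbF.
Qed.

Lemma Dop_vac t :
  act (Dop g h mu l) vacv t = (LamDt g h mu l + wc g / wa g (2 * l) * LamA g h mu l) * vacv t.
Proof.
have := Top_blk g h mu l up_vac true t.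
have -> : (fun s : conf L => up_vac (false, s)) = fun _ => 0 by [].
by rewrite act0 addr0 Top_up_vac ?enum_uniq // /vacD /vacA !big_enum => <-.
Qed.

End Vacuum.

(** * Transposition *)

Section OpTranspose.
Variables (R : realType) (I : finType).
Implicit Types M N : Op R I.

Lemma opmulE M N x y : opmul M N x y = act M (N^~ y) x.
Proof. by []. Qed.

Lemma opmulA : associative (@opmul R I).
Proof.
move=> M N P; apply/funext => x; apply/funext => y.
by rewrite [RHS]opmulE act_mul.
Qed.

Lemma op1mul : left_id (@opid R I) (@opmul R I).
Proof. by move=> M; apply/funext => x; apply/funext => y; rewrite opmulE act_id. Qed.

Lemma opmul1 : right_id (@opid R I) (@opmul R I).
Proof.
move=> M; apply/funext => x; apply/funext => y.
rewrite /opmul (bigD1 y) //= /opid eqxx mulr1 big1 ?addr0 // => z /negPf ->.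
by rewrite mulr0.
Qed.

HB.instance Definition _ :=
  Monoid.isLaw.Build (Op R I) (@opid R I) (@opmul R I) opmulA op1mul opmul1.

Definition optr M : Op R I := fun x y => M y x.

Lemma optr_mul M N : optr (opmul M N) = opmul (optr N) (optr M).
Proof.
apply/funext => x; apply/funext => y.
by apply: eq_bigr => z _; rewrite mulrC.
Qed.

Lemma optr_id : optr (@opid R I) = @opid R I.
Proof. by apply/funext => x; apply/funext => y; rewrite /optr /opid eq_sym. Qed.

Lemma optr_big (J : Type) (s : seq J) (M : J -> Op R I) :
  optr (\big[@opmul R I/@opid R I]_(j <- s) M j) =
  \big[@opmul R I/@opid R I]_(j <- rev s) optr (M j).
Proof.
elim: s => [|j s IH]; first by rewrite !big_nil optr_id.
by rewrite rev_cons big_rcons big_cons optr_mul IH.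
Qed.

End OpTranspose.

Section MonodromyTranspose.
Variables (R : realType) (L : nat) (g h : R[i]) (mu : 'I_L -> R[i]).

Lemma optr_R0j u j : optr (@R0j R L g u j) = R0j g u j.
Proof.
apply/funext => p; apply/funext => q; rewrite /optr /R0j; congr (_ * _).
  rewrite /Rent; case: p q => [a s] [b t] /=.
  by case: a; case: b; case: (s j); case: (t j).
by under eq_forallb => k do rewrite [q.2 k == _]eq_sym.
Qed.

Lemma optr_K0 l : optr (@K0 R L h l) = K0 h l.
Proof.
apply/funext => p; apply/funext => q; rewrite /optr /K0 eq_sym.
by case: eqP => [->|].
Qed.

(** R and K are symmetric matrices, so transposition only reverses the product, which exchanges the
    factors in l - mu and l + mu. *)
Lemma optr_monodromy l :
  optr (monodromy g h mu l) = monodromy g h (fun j => - mu j) l.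
Proof.
rewrite /monodromy !optr_mul !optr_big optr_K0 revK opmulA.
congr opmul; last by apply: eq_bigr => j _; rewrite optr_R0j.
by congr opmul; apply: eq_bigr => j _; rewrite optr_R0j opprK.
Qed.

End MonodromyTranspose.

(** * Lists of spectral parameters with one entry deleted *)

Section Lists.
Variables (R : realType) (n : nat) (x : 'I_n -> R[i]) (k : 'I_n).

Lemma dels_map (P Q : Type) (f : P -> Q) i s : dels i (map f s) = map f (dels i s).
Proof. by rewrite /dels map_cat map_take map_drop. Qed.

Lemma dels_enum : dels k (enum 'I_n) = [seq j <- enum 'I_n | j != k].
Proof. by rewrite -(rem_filter _ (enum_uniq _)) remE index_enum_ord. Qed.

Lemma big_dels (F : R[i] -> R[i]) :
  \prod_(y <- dels k [seq x j | j <- enum 'I_n]) F y = \prod_(j < n | j != k) F (x j).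
Proof. by rewrite dels_map big_map dels_enum big_filter big_enum_cond. Qed.

(** Identifies the unwanted terms of [bethe_action] with Bethe vectors at the tuples of the
    statement. *)
Lemma del0_list lam0 :
  [seq del0 lam0 x k j | j <- enum 'I_n] = lam0 :: dels k [seq x j | j <- enum 'I_n].
Proof.
set xs := [seq x j | j <- enum 'I_n].
have sxs : size xs = n by rewrite size_map size_enum_ord.
apply: (@eq_from_nth _ 0) => [|i]; rewrite size_map size_enum_ord.
  rewrite /= /dels size_cat size_take size_drop sxs ltn_ord.
  by rewrite -addSn subnKC ?ltn_ord.
move=> ltin; rewrite (nth_map (Ordinal ltin)) ?size_enum_ord //.
rewrite /del0 -/xs [nat_of_ord (nth _ _ _)]nth_enum_ord //.
(* Position 0 holds [lam0]; position i + 1 holds entry i of [xs] if i < k, and entry i + 1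
   otherwise. *)
case: i ltin => [|i] ltin //=; rewrite /dels nth_cat size_take sxs ltn_ord.
case: ltnP => ki /=; first by rewrite nth_take.
by rewrite nth_drop addSn subnKC.
Qed.

End Lists.

(** * The double-row operators as linear maps *)

Section Vectors.
Variables (R : realType) (I : finType).
Local Notation V := {ffun I -> (R[i])^o}.

Definition opv (M : Op R I) (v : V) : V := [ffun x => act M v x].

Lemma opv_linear M : linear (opv M).
Proof.
move=> c u v; apply/ffunP => x; rewrite !ffunE /act scaler_sumr -big_split.
by apply: eq_bigr => y _; rewrite /= !ffunE mulrDr [M x y * _]mulrCA.
Qed.

HB.instance Definition _ M :=
  GRing.isLinear.Build R[i] V V _ (opv M) (opv_linear M).

Lemma opvE M v x : opv M v x = act M v x.
Proof. by rewrite ffunE. Qed.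

(** Bilinear, without conjugation, so that the adjoint of an operator is its plain transpose. *)
Definition pairing (u v : V) : R[i] := \sum_x u x * v x.

Lemma pairingC u v : pairing u v = pairing v u.
Proof. by apply: eq_bigr => x _; rewrite mulrC. Qed.

Lemma pairing_linear u : linear_for *%R (pairing u).
Proof.
move=> c v w; rewrite /pairing mulr_sumr -big_split.
by apply: eq_bigr => x _; rewrite /= !ffunE mulrDr mulrCA.
Qed.

HB.instance Definition _ u :=
  GRing.isLinear.Build R[i] V R[i] *%R (pairing u) (pairing_linear u).

Lemma pairing_tr M u v : pairing u (opv M v) = pairing (opv (optr M) u) v.
Proof.
rewrite /pairing; under eq_bigr => x _ do rewrite opvE mulr_sumr.
rewrite exchange_big; apply: eq_bigr => y _.
rewrite opvE mulr_suml; apply: eq_bigr => x _.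
by rewrite /optr mulrA [u x * _]mulrC.
Qed.

End Vectors.

Section DoubleRow.
Variables (R : realType) (L : nat) (g h : R[i]) (mu : 'I_L -> R[i]).
Local Notation V := {ffun conf L -> (R[i])^o}.
Implicit Types (l m y : R[i]) (i j : bool) (v : V).

(** This shift of D removes the term B(m) A(l) of [exchange_DB], giving the shape that
    [bethe_action] expects. *)
Definition Dtop l : Op R (conf L) :=
  fun s t => Dop g h mu l s t - wc g / wa g (2 * l) * Aop g h mu l s t.

Definition opB l : {linear V -> V} := opv (Bop g h mu l).
Definition opX i l : {linear V -> V} := opv (if i then Dtop l else Aop g h mu l).
Definition vacX i l : R[i] := if i then LamDt g h mu l else LamA g h mu l.
Definition Om : V := [ffun t => vacv R t].
(** D~(l) divides by a(2 l) and A(l) does not, so A(lam0) puts no condition on a(2 lam0). *)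
Definition okX i l := i -> wa g (2 * l) != 0.
Definition good l m := (wb (m - l) != 0) && (wa g (m + l) != 0).

Lemma act_Dtop l (f : conf L -> R[i]) x :
  act (Dtop l) f x = act (Dop g h mu l) f x - wc g / wa g (2 * l) * act (Aop g h mu l) f x.
Proof.
rewrite /act mulr_sumr -sumrB; apply: eq_bigr => z _.
by rewrite mulrBl mulrA.
Qed.

Lemma opB_E l v : (opB l v : conf L -> R[i]) = act (Bop g h mu l) v.
Proof. by apply/funext => t; apply: opvE. Qed.

Lemma opX_E i l v :
  (opX i l v : conf L -> R[i]) = act (if i then Dtop l else Aop g h mu l) v.
Proof. by apply/funext => t; apply: opvE. Qed.

Lemma opB_comm l m v : opB l (opB m v) = opB m (opB l v).
Proof.
by apply/ffunP => t; rewrite !opB_E exchange_BB.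
Qed.

Lemma okX_all l : (forall i, okX i l) -> wa g (2 * l) != 0.
Proof. by move/(_ true); apply. Qed.

Lemma opX_exchange i l m v : okX i l -> (forall j, okX j m) -> good l m ->
  opX i l (opB m v) = wal g i l m *: opB m (opX i l v)
    + \sum_(j : bool) wbe g i j l m *: opB l (opX j m v).
Proof.
move=> okl /okX_all/csinh_cexp_neq0 am /andP[bml aml]; rewrite big_bool.
have bml' := etrans (wb_subC_neq0 _ _) bml.
apply/ffunP => t; rewrite !ffunE opX_E !opB_E !opX_E.
have ED k : act (Dtop k) v = fun s => 1 * act (Dop g h mu k) v s
    + - (wc g / wa g (2 * k)) * act (Aop g h mu k) v s.
  by apply/funext => t'; rewrite act_Dtop mul1r mulNr.
have sc (x y : R[i]) : x *: (y : (R[i])^o) = x * y by [].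
have nA : wb (m - l) * wa g (m + l) != 0 by rewrite mulf_neq0.
have nD : wb (l - m) * wa g (l + m) != 0 by rewrite mulf_neq0 // addrC.
have eA := canRL (mulKf nA) (exchange_AB g h mu l m v t).
have eD := canRL (mulKf nD) (exchange_DB g h mu l m v t).
have H1 := (wb_cexp_neq0 bml, wb_cexp_neq0 bml').
have aml' := aml; rewrite addrC in aml'.
have H2 := (csinh_cexp_neq0 aml, csinh_cexp_neq0 aml'); rewrite !cexpD in H2.
rewrite cexpD cexp2 in am.
case: i okl => [/(_ isT)/csinh_cexp_neq0|_]; rewrite !ED ?actD ?actZ !sc ?act_Dtop /wal /wbe.
  rewrite cexpD cexp2 => al; rewrite eD eA.
  (* With the products of operators generalized to scalars, only an identity between coefficients is
     left. *)
  do 4 move: (act _ _ t).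
  by move=> x1 x2 x3 x4; trig_field; rewrite ?H1 ?H2 ?am ?al.
rewrite eA; do 3 move: (act _ _ t).
by move=> x1 x2 x3; trig_field; rewrite ?H1 ?H2 ?am.
Qed.

Lemma opX_vac i l : okX i l -> opX i l Om = vacX i l *: Om.
Proof.
have E : (Om : conf L -> R[i]) = vacv R (L:=L) by apply/funext => t; rewrite ffunE.
move=> okl; apply/ffunP => t; rewrite opX_E [RHS]ffunE E.
case: i okl => [/(_ isT) al|_]; last exact: Aop_vac.
by rewrite act_Dtop Dop_vac // Aop_vac mulrA -mulrBl addrK.
Qed.

End DoubleRow.

(** * The scalar product *)

Section ScalarProduct.
Variables (R : realType) (L : nat) (g h : R[i]).
Implicit Types (mu : 'I_L -> R[i]).

Definition bethev mu n (x : 'I_n -> R[i]) :=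
  bethe (opB g h mu) (Om R L) [seq x j | j <- enum 'I_n].

Lemma bethevE mu n (x : 'I_n -> R[i]) t :
  bethev mu x t = (\big[@opmul R _/@opid R _]_(k <- enum 'I_n) Bop g h mu (x k)) t (vac L).
Proof.
set M := \big[_/_]_(_ <- _) _.
have -> : M t (vac L) = act M (vacv R (L:=L)) t.
  rewrite /act (bigD1 (vac L)) //= /vacv eqxx mulr1 big1 ?addr0 // => s /negPf ->.
  by rewrite mulr0.
rewrite act_big /bethev /bethe foldr_map; congr (_ t).
elim: (enum _) => [|k s IH] /=; first by apply/funext => s; rewrite ffunE.
by rewrite opB_E -IH.
Qed.

Lemma optr_Cop mu l : optr (Cop g h mu l) = Bop g h (fun j => - mu j) l.
Proof.
apply/funext => s; apply/funext => t.
by rewrite /Bop -optr_monodromy.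
Qed.

Lemma optr_Aop mu l : optr (Aop g h mu l) = Aop g h (fun j => - mu j) l.
Proof.
apply/funext => s; apply/funext => t.
by rewrite [RHS]/Aop -optr_monodromy.
Qed.

(** Transposing the product of C's turns its vacuum row into a Bethe vector for the opposite
    inhomogeneities. *)
Lemma scalprodE mu n (xC xB : 'I_n -> R[i]) :
  scalprod g h mu xC xB = pairing (bethev (fun j => - mu j) xC) (bethev mu xB).
Proof.
apply: eq_bigr => t _; rewrite !bethevE; congr (_ * _).
rewrite -[LHS]/(optr _ t (vac L)) optr_big revK.
by under eq_bigr => k _ do rewrite optr_Cop.
Qed.

(** With [LamDt_opp], this gives both expansions coefficients of the same form. *)
Lemma LamA_opp mu l : LamA g h (fun j => - mu j) l = LamA g h mu l.
Proof.
by congr (_ * _); apply: eq_bigr => j _; rewrite opprK mulrC.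
Qed.

Lemma LamDt_opp mu l : LamDt g h (fun j => - mu j) l = LamDt g h mu l.
Proof.
by congr (_ * _); apply: eq_bigr => j _; rewrite opprK mulrC.
Qed.

Lemma Ncoef_opp mu n lam0 (x : 'I_n -> R[i]) k :
  Ncoef g h (fun j => - mu j) lam0 x k = Ncoef g h mu lam0 x k.
Proof. by rewrite /Ncoef LamA_opp LamDt_opp. Qed.

Lemma opA_bethev mu n lam0 (x : 'I_n -> R[i])
  (h1 : forall k, wb (x k - lam0) != 0) (h2 : forall k, wa g (x k + lam0) != 0)
  (h3 : forall k, wa g (2 * x k) != 0)
  (h4 : forall j k, j != k -> wb (x j - x k) != 0)
  (h5 : forall j k, j != k -> wa g (x j + x k) != 0) :
  opv (Aop g h mu lam0) (bethev mu x) =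
  (LamA g h mu lam0 * \prod_(k < n) wal g false lam0 (x k)) *: bethev mu x
  + \sum_(k < n) - Ncoef g h mu lam0 x k *: bethev mu (del0 lam0 x k).
Proof.
set xs := [seq x j | j <- enum 'I_n].
have sxs : size xs = n by rewrite size_map size_enum_ord.
have nthx (k : 'I_n) : nth 0 xs k = x k.
  by rewrite (nth_map k) ?size_enum_ord // nth_ord_enum.
have pw : pairwise (good g) xs.
  rewrite pairwise_map; have := enum_uniq 'I_n; rewrite uniq_pairwise.
  apply: sub_pairwise => j k /= njk.
  by rewrite /good /= h4 1?h5 // eq_sym.
have al : all (good g lam0) xs by apply/allP => _ /mapP[k _ ->]; rewrite /good h1 h2.
have okx (k : 'I_(size xs)) (j : bool) : okX g j (nth 0 xs k).
  by have /mapP[i _ ->] := mem_nth 0 (ltn_ord k); move=> _.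
have cocycle i j l m y : okX g i l -> (forall k, okX g k m) -> (forall k, okX g k y) ->
    good g l m -> good g l y -> good g m y ->
    wal g i l m * wbe g i j l y + \sum_(k : bool) wbe g i k l m * wbe g k j m y
    = wbe g i j l y * wal g j y m.
  move=> okl /okX_all okm /okX_all oky /andP[? ?] /andP[? ?] /andP[? ?].
  exact: wbe_cocycle.
have okl : okX g false lam0 by [].
have := bethe_action (@opB_comm _ _ g h mu) (@opX_exchange _ _ g h mu)
  (@opX_vac _ _ g h mu) cocycle okl okx al pw.
rewrite -[opX g h mu false lam0 _]/(opv _ _) -/(bethev mu x) => ->.
rewrite {1}/bethe_weight big_map big_enum; congr (_ + _).
(* A summand indexed by naturals allows the bound [size xs] to be replaced by [n]. *)
pose F k := (\sum_(j : bool) wbe g false j lam0 xs`_k *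
   bethe_weight (wal g) (vacX g h mu) j xs`_k (dels k xs)) *:
   opB g h mu lam0 (bethe (opB g h mu) (Om R L) (dels k xs)).
rewrite -(big_mkord xpredT F) sxs big_mkord; apply: eq_bigr => k _.
rewrite /F /bethev del0_list -/xs; congr (_ *: _).
rewrite big_bool /bethe_weight /= nthx !big_dels /Ncoef /=.
by ring.
Qed.

Lemma pairing_opA u mu n lam0 (x : 'I_n -> R[i])
  (h1 : forall k, wb (x k - lam0) != 0) (h2 : forall k, wa g (x k + lam0) != 0)
  (h3 : forall k, wa g (2 * x k) != 0)
  (h4 : forall j k, j != k -> wb (x j - x k) != 0)
  (h5 : forall j k, j != k -> wa g (x j + x k) != 0) :
  pairing u (opv (Aop g h mu lam0) (bethev mu x)) =
  LamA g h mu lam0 * \prod_(k < n) wal g false lam0 (x k) * pairing u (bethev mu x)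
  - \sum_(k < n) Ncoef g h mu lam0 x k * pairing u (bethev mu (del0 lam0 x k)).
Proof.
rewrite opA_bethev // linearD linearZ linear_sum -sumrN /=; congr (_ + _).
by apply: eq_bigr => k _; rewrite linearZ /= mulNr.
Qed.

End ScalarProduct.

Theorem theorem1 (R : realType) (L : nat) (hL : (0 < L)%N)
  (g h : R[i]) (mu : 'I_L -> R[i]) (n : nat) (hn : (0 < n)%N)
  (lam0 : R[i]) (xC xB : 'I_n -> R[i])
  (* genericity: every denominator occurring in the statement is non-zero *)
  (hC1 : forall k, wb (xC k - lam0) != 0) (hC2 : forall k, wa g (xC k + lam0) != 0)
  (hC3 : forall k, wa g (2 * xC k) != 0)
  (hC4 : forall j k, j != k -> wb (xC j - xC k) != 0)
  (hC5 : forall j k, j != k -> wa g (xC j + xC k) != 0)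
  (hC6 : forall j k, j != k -> wb (xC j + xC k + g) != 0)
  (hB1 : forall k, wb (xB k - lam0) != 0) (hB2 : forall k, wa g (xB k + lam0) != 0)
  (hB3 : forall k, wa g (2 * xB k) != 0)
  (hB4 : forall j k, j != k -> wb (xB j - xB k) != 0)
  (hB5 : forall j k, j != k -> wa g (xB j + xB k) != 0)
  (hB6 : forall j k, j != k -> wb (xB j + xB k + g) != 0) :
  M0 g h mu lam0 xC xB * scalprod g h mu xC xB
  + \sum_(k < n) Ncoef g h mu lam0 xC k * scalprod g h mu (del0 lam0 xC k) xB
  + \sum_(k < n) (- Ncoef g h mu lam0 xB k) * scalprod g h mu xC (del0 lam0 xB k)
  = 0.
Proof.
(* The matrix element of A(lam0) between the two Bethe vectors; each side is then expanded by
   [pairing_opA]. *)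
have := pairing_tr (Aop g h mu lam0) (bethev g h (fun j => - mu j) xC) (bethev g h mu xB).
rewrite optr_Aop [RHS]pairingC !pairing_opA // LamA_opp [pairing _ (bethev _ _ _ xC)]pairingC.
under [X in _ - X = _]eq_bigr => k _ do rewrite -scalprodE.
under [X in _ = _ - X]eq_bigr => k _ do rewrite Ncoef_opp pairingC -scalprodE.
rewrite -scalprodE /M0 => E.
under [X in _ + X = _]eq_bigr => k _ do rewrite mulNr.
rewrite sumrN; move/eqP: E; rewrite -subr_eq0 => /eqP E.
(* The two diagonal terms combine into [M0]. *)
by rewrite -[RHS]E /wal /=; ring.
Qed.
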